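(* Let $Q$ be a configuration manifold of dimension $N$, $X={\mathbb R}$, $Y={\mathbb R}\times Q$, and let $L:TQ\to{\mathbb R}$ be a Lagrangian whose Legendre transformation is nondegenerate, with primary constraint manifold $P_{\mathcal L}={\mathbb R}\times T^*Q$, Hamiltonian $H:T^*Q\to{\mathbb R}$ and Hamiltonian density ${\mathcal H}=H\,dt$. Let $\bar V$ be a vector field on $P_{\mathcal L}$ with integral curve $\tilde{j}^1(\phi)$. Then $\bar V$ is a Hamiltonian vector field for $H$ if and only if $\tilde{j}^1(\phi)$ is a Hamiltonian section for ${\mathcal H}$.
   Context: Sections $\phi$ of $Y={\mathbb R}\times Q\to{\mathbb R}$ are curves $t\mapsto(t,q(t))$. The product structure gives $Y$ a flat (trivial) connection. The first jet bundle is $J^1(Y)={\mathbb R}\times TQ$, with coordinates $(t,q^A,\dot q^A)$, and the Lagrangian density is ${\mathcal L}=L\,dt$. The dual jet bundle is $J^1(Y)^\star=T^*{\mathbb R}\times T^*Q$, with coordinates $(t,p,q^A,p_A)$. The covariant Legendre transformation is ${\mathbb F}{\mathcal L}(t,q^A,\dot q^A)=(t,\,L-p_A\dot q^A,\,q^A,\,p_A)$ with $p_A=\partial L/\partial\dot q^A$. Its image $P_{\mathcal L}$ is identified with ${\mathbb R}\times T^*Q$, with coordinates $(t,q^A,p_A)$. The Legendre transformation is assumed nondegenerate in the usual sense, so that ${\mathbb F}{\mathcal L}:{\mathbb R}\times TQ\to P_{\mathcal L}$ is a fiber-preserving diffeomorphism over ${\mathbb R}$ and $H=p_A\dot q^A-L$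 is a well-defined function on $T^*Q$. The form on $P_{\mathcal L}$ is $\Omega_{\mathcal H}=dq^A\wedge dp_A+dH\wedge dt$. For a section $\phi$, $\tilde{j}^1(\phi)={\mathbb F}{\mathcal L}\circ j^1(\phi)$, where $j^1(\phi)(t)=(t,q(t),\dot q(t))$. It is called a Hamiltonian section for ${\mathcal H}$ if $\tilde{j}^1(\phi)^*(U\lrcorner\,\Omega_{\mathcal H})=0$ for every $U\in T(P_{\mathcal L})$, where $\lrcorner$ denotes interior product. A vector field $\bar V$ on $P_{\mathcal L}={\mathbb R}\times T^*Q$, with $t$-component $1$, is a Hamiltonian vector field for $H$ if its component along $T^*Q$ is the Hamiltonian vector field of $H$ for the canonical symplectic form $dq^A\wedge dp_A$, that is, $\bar V=\frac{\partial}{\partial t}+\frac{\partial H}{\partial p_A}\frac{\partial}{\partial q^A}-\frac{\partial H}{\partial q^A}\frac{\partial}{\partial p_A}$.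
   Formalization: One integral curve cannot determine V̄ elsewhere, so the equivalence is proved with ''V̄ is Hamiltonian'' taken at the points of the curve, and for V̄ on all of P_L when integral curves of the form j̃¹(φ), φ possibly local, pass through every point and all of them are considered. *)

(* Defs.v *)
From HB Require Import structures.
From mathcomp Require Import all_boot all_order all_algebra.
From mathcomp Require Import all_classical all_reals all_analysis.
Import Order.TTheory GRing.Theory Num.Theory numFieldNormedType.Exports.
Set Implicit Arguments.
Unset Strict Implicit.
Unset Printing Implicit Defensive.
Local Open Scope classical_set_scope.
Local Open Scope ring_scope.

(* f is of class C^k at the points of D (D is an open set in all the uses) *)
Fixpoint Ck (R : realType) (V W : normedModType R) (k : nat) (D : set V)
    (f : V -> W) : Prop :=
  if k is k'.+1 then
    (forall x, D x -> differentiable f x) /\ (forall v, Ck k' D ('D_v f))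
  else forall x, D x -> {for x, continuous f}.

Definition smooth_on (R : realType) (V W : normedModType R) (D : set V)
    (f : V -> W) : Prop :=
  forall k, Ck k D f.

(* An atlas only carries the data of the charts.  In this way the natural
   (bundle) coordinates of TM, T*M and of products are defined without first
   proving that these spaces are manifolds; the axioms of a manifold are
   collected in [smooth_manifold].  The value of [chart i] outside of [dom i]
   is irrelevant. *)
Record atlas (R : realType) (M : Type) (n : nat) := Atlas {
  chart_index : Type;
  dom : chart_index -> set M;
  chart : chart_index -> M -> 'rV[R]_n }.

(* f \o (chart i)^-1, extended by 0 outside of the image of the chart *)
Definition coord_rep (R : realType) (M : Type) (n : nat) (A : atlas R M n)
    (W : normedModType R) (i : chart_index A) (f : M -> W) : 'rV[R]_n -> W :=
  fun y => if pselect (exists m, dom i m /\ chart i m = y) is left e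
           then f (projT1 (cid e)) else 0.

Definition transition (R : realType) (M : Type) (n : nat) (A : atlas R M n)
    (i j : chart_index A) : 'rV[R]_n -> 'rV[R]_n :=
  coord_rep i (chart j).

Definition smooth_manifold (R : realType) (M : topologicalType) (n : nat)
    (A : atlas R M n) : Prop :=
  [/\ hausdorff_space M /\ @second_countable M,
      (forall m, exists i : chart_index A, dom i m),
      (forall i : chart_index A,
          open (dom i) /\ {in dom i &, injective (chart i)}),
      (* each chart is a homeomorphism onto an open subset of R^n *)
      (forall i : chart_index A,
          (forall O : set 'rV[R]_n, open O -> open (dom i `&` chart i @^-1` O))
          /\ (forall O, open O -> O `<=` dom i -> open (chart i @` O))) &
      (forall i j : chart_index A,
          smooth_on (chart i @` (dom i `&` dom j)) (transition i j))].

Definition real_atlas (R : realType) : atlas R R 1 :=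
  @Atlas R R 1 unit (fun _ => setT) (fun _ t => const_mx t).

Definition prod_atlas (R : realType) (M M' : Type) (m n : nat)
    (A : atlas R M m) (B : atlas R M' n) : atlas R (M * M') (m + n) :=
  @Atlas R (M * M') (m + n) (chart_index A * chart_index B)
    (fun ij => [set x | dom ij.1 x.1 /\ dom ij.2 x.2])
    (fun ij x => row_mx (chart ij.1 x.1) (chart ij.2 x.2)).

Definition smooth_map_on (R : realType) (M M' : Type) (m n : nat)
    (A : atlas R M m) (B : atlas R M' n) (D : set M) (F : M -> M') : Prop :=
  forall (i : chart_index A) (j : chart_index B),
    let E := D `&` dom i `&` F @^-1` dom j in
    open (chart i @` E) /\
    smooth_on (chart i @` E) (coord_rep i (chart j \o F)).

Definition smooth_map (R : realType) (M M' : Type) (m n : nat)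
    (A : atlas R M m) (B : atlas R M' n) (F : M -> M') : Prop :=
  smooth_map_on A B setT F.

Definition diffeomorphism (R : realType) (M M' : Type) (m n : nat)
    (A : atlas R M m) (B : atlas R M' n) (F : M -> M') : Prop :=
  smooth_map A B F /\
  exists G : M' -> M, [/\ cancel F G, cancel G F & smooth_map B A G].

(* A tangent vector at x is the family of its components in all charts around
   x, related by the Jacobian matrices of the transition maps.  The components
   in the charts not containing x are set to 0, so that equal vectors are equal
   families.  The library's Jacobian acts on row vectors on the right. *)
Record tangent (R : realType) (M : Type) (n : nat) (A : atlas R M n) (x : M) :=
  Tangent {
    tcomp : chart_index A -> 'rV[R]_n;
    tcomp_change : forall i j, dom i x -> dom j x ->
      tcomp j = tcomp i *m jacobian (transition i j) (chart i x);
    tcomp_out : forall i, ~ dom i x -> tcomp i = 0 }.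

(* Covectors: p_i = p_j . d(transition i j), which makes p_i . v_i independent
   of the chart. *)
Record cotangent (R : realType) (M : Type) (n : nat) (A : atlas R M n) (x : M)
  := Cotangent {
    ccomp : chart_index A -> 'rV[R]_n;
    ccomp_change : forall i j, dom i x -> dom j x ->
      ccomp i = ccomp j *m (jacobian (transition i j) (chart i x))^T;
    ccomp_out : forall i, ~ dom i x -> ccomp i = 0 }.

Program Definition tangent0 (R : realType) (M : Type) (n : nat)
    (A : atlas R M n) (x : M) : tangent A x :=
  @Tangent R M n A x (fun=> 0) _ _.
Next Obligation. by move=> *; rewrite mul0mx. Qed.
Next Obligation. by []. Qed.

Program Definition cotangent0 (R : realType) (M : Type) (n : nat)
    (A : atlas R M n) (x : M) : cotangent A x :=
  @Cotangent R M n A x (fun=> 0) _ _.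
Next Obligation. by move=> *; rewrite mul0mx. Qed.
Next Obligation. by []. Qed.

Definition TB (R : realType) (M : Type) (n : nat) (A : atlas R M n) : Type :=
  {x : M & tangent A x}.

Definition CB (R : realType) (M : Type) (n : nat) (A : atlas R M n) : Type :=
  {x : M & cotangent A x}.

(* natural coordinates (q, qdot) and (q, p) *)
Definition tangent_atlas (R : realType) (M : Type) (n : nat) (A : atlas R M n) :
    atlas R (TB A) (n + n) :=
  @Atlas R (TB A) (n + n) (chart_index A)
    (fun i => [set v | dom i (projT1 v)])
    (fun i v => row_mx (chart i (projT1 v)) (tcomp (projT2 v) i)).

Definition cotangent_atlas (R : realType) (M : Type) (n : nat)
    (A : atlas R M n) : atlas R (CB A) (n + n) :=
  @Atlas R (CB A) (n + n) (chart_index A)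
    (fun i => [set a | dom i (projT1 a)])
    (fun i a => row_mx (chart i (projT1 a)) (ccomp (projT2 a) i)).

(* u . v, i.e. the contraction u_A v^A of component rows *)
Definition dot (R : realType) (n : nat) (u v : 'rV[R]_n) : R :=
  \sum_(a < n) u 0 a * v 0 a.

(* p_A v^A, the common value of the contraction in all charts around x *)
Definition pairing (R : realType) (M : Type) (n : nat) (A : atlas R M n)
    (x : M) (p : cotangent A x) (v : tangent A x) : R :=
  xget 0 [set s | forall i, dom i x -> s = dot (ccomp p i) (tcomp v i)].

Definition is_velocity (R : realType) (M : Type) (n : nat) (A : atlas R M n)
    (c : R -> M) (t : R) (v : tangent A (c t)) : Prop :=
  forall i : chart_index A, dom i (c t) ->
    (\forall s \near t, dom i (c s)) /\
    is_derive t 1 (fun s => chart i (c s)) (tcomp v i).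

(* the velocity c'(t), with value 0 by default where c is not differentiable *)
Definition velocity (R : realType) (M : Type) (n : nat) (A : atlas R M n)
    (c : R -> M) (t : R) : tangent A (c t) :=
  @xget {classic (tangent A (c t))} (tangent0 A (c t))
    [set v | is_velocity v].

Definition vector_field (R : realType) (M : Type) (n : nat) (A : atlas R M n) :
    Type :=
  forall x : M, tangent A x.

Definition smooth_vector_field (R : realType) (M : Type) (n : nat)
    (A : atlas R M n) (V : vector_field A) : Prop :=
  forall i : chart_index A,
    smooth_on (chart i @` dom i) (coord_rep i (fun x => tcomp (V x) i)).

Definition integral_curve (R : realType) (M : Type) (n : nat) (A : atlas R M n)
    (V : vector_field A) (J : set R) (c : R -> M) : Prop :=
  forall t, J t -> is_velocity (V (c t)).

(* J^1(Y) = R x TQ *)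
Definition jet_atlas (R : realType) (Q : Type) (N : nat) (A : atlas R Q N) :
    atlas R (R * TB A) (1 + (N + N)) :=
  prod_atlas (real_atlas R) (tangent_atlas A).

(* P_L = R x T*Q, with natural coordinates (t, q, p) *)
Definition PL_atlas (R : realType) (Q : Type) (N : nat) (A : atlas R Q N) :
    atlas R (R * CB A) (1 + (N + N)) :=
  prod_atlas (real_atlas R) (cotangent_atlas A).

(* partial derivatives of a function of two groups of variables, (q, qdot) or
   (q, p) *)
Definition partial1 (R : realType) (N : nat) (f : 'rV[R]_(N + N) -> R)
    (y : 'rV[R]_(N + N)) : 'rV[R]_N :=
  \row_a 'D_(row_mx (delta_mx 0 a) 0) f y.

Definition partial2 (R : realType) (N : nat) (f : 'rV[R]_(N + N) -> R)
    (y : 'rV[R]_(N + N)) : 'rV[R]_N :=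
  \row_a 'D_(row_mx 0 (delta_mx 0 a)) f y.

(* the covector with components p_A = dL/dqdot^A in every chart *)
Definition momentum (R : realType) (Q : Type) (N : nat) (A : atlas R Q N)
    (L : TB A -> R) (v : TB A) : cotangent A (projT1 v) :=
  @xget {classic (cotangent A (projT1 v))} (cotangent0 A (projT1 v))
    [set p | forall i : chart_index A, dom i (projT1 v) ->
       ccomp p i = partial2 (coord_rep (A := tangent_atlas A) i L)
                            (chart (a := tangent_atlas A) i v)].

(* FL(t, q, qdot) = (t, L - p_A qdot^A, q, p_A), with values in the dual jet
   bundle T*R x T*Q; T*R is R * R with coordinates (t, p). *)
Definition covariant_legendre (R : realType) (Q : Type) (N : nat)
    (A : atlas R Q N) (L : TB A -> R) (x : R * TB A) : (R * R) * CB A :=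
  let p := momentum L x.2 in
  ((x.1, L x.2 - pairing p (projT2 x.2)), existT _ (projT1 x.2) p).

(* the image of FL is identified with R x T*Q by forgetting the coordinate p *)
Definition FL (R : realType) (Q : Type) (N : nat) (A : atlas R Q N)
    (L : TB A -> R) (x : R * TB A) : R * CB A :=
  let y := covariant_legendre L x in (y.1.1, y.2).

Definition nondegenerate_lagrangian (R : realType) (Q : Type) (N : nat) (A : atlas R Q N)
    (L : TB A -> R) : Prop :=
  diffeomorphism (jet_atlas A) (PL_atlas A) (FL L).

(* H = p_A qdot^A - L; the Legendre map being bijective, this determines H *)
Definition is_hamiltonian_of (R : realType) (Q : Type) (N : nat)
    (A : atlas R Q N) (L : TB A -> R) (H : CB A -> R) : Prop :=
  forall v : TB A,
    H (existT _ (projT1 v) (momentum L v))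
    = pairing (momentum L v) (projT2 v) - L v.

(* A (possibly local) smooth section t |-> (t, q t) of R x Q -> R over the open
   interval J; the values of q outside of J are irrelevant. *)
Definition local_section (R : realType) (Q : Type) (N : nat) (A : atlas R Q N)
    (J : set R) (q : R -> Q) : Prop :=
  [/\ open J, is_interval J & smooth_map_on (real_atlas R) A J q].

Definition jet (R : realType) (Q : Type) (N : nat) (A : atlas R Q N)
    (q : R -> Q) (t : R) : R * TB A :=
  (t, existT _ (q t) (velocity A q t)).

Definition jtilde (R : realType) (Q : Type) (N : nat) (A : atlas R Q N)
    (L : TB A -> R) (q : R -> Q) : R -> R * CB A :=
  FL L \o jet A q.

(* Expression of Omega_H = dq^A /\ dp_A + dH /\ dt in the natural chart i at
   the point z, with (a /\ b)(U, W) = a(U) b(W) - a(W) b(U).  In the natural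
   coordinates U = (tau, xi, pi) has U_t = tau, U_q = xi, U_p = pi. *)
Definition OmegaH (R : realType) (Q : Type) (N : nat) (A : atlas R Q N)
    (H : CB A -> R) (i : chart_index A) (z : R * CB A)
    (U W : tangent (PL_atlas A) z) : R :=
  let u : 'rV[R]_(1 + (N + N)) := tcomp U (tt, i) in
  let w : 'rV[R]_(1 + (N + N)) := tcomp W (tt, i) in
  let dt (x : 'rV[R]_(1 + (N + N))) : R := lsubmx x 0 0 in
  let dq (x : 'rV[R]_(1 + (N + N))) : 'rV[R]_N := lsubmx (rsubmx x) in
  let dp (x : 'rV[R]_(1 + (N + N))) : 'rV[R]_N := rsubmx (rsubmx x) in
  let dH (x : 'rV[R]_(1 + (N + N))) : R :=
    'D_(rsubmx x) (coord_rep (A := cotangent_atlas A) i H)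
                  (chart (a := cotangent_atlas A) i z.2) in
  (dot (dq u) (dp w) - dot (dq w) (dp u)) + (dH u * dt w - dH w * dt u).

(* The pullback of the 1-form U _| Omega_H by a curve c is
   Omega_H(U, c'(t)) dt. *)
Definition hamiltonian_section (R : realType) (Q : Type) (N : nat)
    (A : atlas R Q N) (L : TB A -> R) (H : CB A -> R) (J : set R)
    (q : R -> Q) : Prop :=
  forall t, J t ->
  forall U : tangent (PL_atlas A) (jtilde L q t),
  forall i : chart_index A, dom i (q t) ->
    OmegaH H i U (velocity (PL_atlas A) (jtilde L q) t) = 0.

(* V = d/dt + dH/dp_A d/dq^A - dH/dq^A d/dp_A at the points of D, in all
   natural charts *)
Definition hamiltonian_along (R : realType) (Q : Type) (N : nat)
    (A : atlas R Q N) (H : CB A -> R) (V : vector_field (PL_atlas A))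
    (D : set (R * CB A)) : Prop :=
  forall z, D z ->
  forall i : chart_index A, dom i (projT1 z.2) ->
    let h := coord_rep (A := cotangent_atlas A) i H in
    let y := chart (a := cotangent_atlas A) i z.2 in
    tcomp (V z) (tt, i)
    = row_mx (const_mx 1) (row_mx (partial2 h y) (- partial1 h y)).

Definition hamiltonian_vector_field (R : realType) (Q : Type) (N : nat)
    (A : atlas R Q N) (H : CB A -> R) (V : vector_field (PL_atlas A)) : Prop :=
  hamiltonian_along H V setT.

(* Main.v *)
(* Along jtilde q the time component of the velocity V is 1, so for a vector
   U = (tau, xi, pi) in natural coordinates Omega_H(U, V) is affine in the
   components of V, and evaluating it at U = d/dq^A and U = d/dp_A yields exactly
   Hamilton's equations; conversely these make it vanish for all U.  This needs
   that H is differentiable in the natural charts and that every coordinate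
   vector is a tangent vector of P_L, i.e. that the natural charts of P_L have
   differentiable transitions.  Both come from the Legendre diffeomorphism:
   H = p.v - L composed with FL^-1, and a transition of P_L is locally a chart
   representative of FL^-1 followed by one of FL. *)
From HB Require Import structures.
Require Import Defs.
From mathcomp Require Import all_boot all_order all_algebra.
From mathcomp Require Import all_classical all_reals all_analysis.
Import Order.TTheory GRing.Theory Num.Theory numFieldNormedType.Exports.
Local Open Scope classical_set_scope.
Local Open Scope ring_scope.

Set Implicit Arguments.
Unset Strict Implicit.
Unset Printing Implicit Defensive.

(** * Calculus on row vectors *)

(** The differential of [f] also approximates [g] to first order at [x]; uniqueness of the
    differential identifies it with ['d g x]. *)
Lemma near_eq_differentiable (R : numFieldType) (V W : normedModType R)
    (f g : V -> W) (x : V) :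
  {near x, f =1 g} -> differentiable f x -> differentiable g x.
Proof.
move=> fg df; have fgx := nbhs_singleton fg.
have gE : g \o shift x = cst (g x) + 'd f x +o_ 0 id.
  apply/eqaddoP; rewrite -fgx => e e0.
  have /eqaddoP/(_ e e0) := diff_locally df.
  have : \forall h \near 0, f (h + x) = g (h + x).
    have : \forall y \near x, f y = g y by [].
    by rewrite [\forall y \near x, _](near_shift 0) subr0.
  by apply: filterS2 => h /= fgh; rewrite !fctE /= fgh.
have dgE : 'd g x = 'd f x :> (V -> W).
  by apply: diff_unique => //; exact: diff_continuous.
by apply/diff_locallyP; rewrite dgE; split => //; exact: diff_continuous.
Qed.

Lemma row_mx_continuous (R : realType) m n (v : 'rV[R]_m) :
  continuous (fun y : 'rV[R]_n => row_mx v y).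
Proof.
move=> u B /nbhs_ballP[e /= e0 eB].
apply/nbhs_ballP; exists e => //= w [_ uw]; apply: eB; split => // i j.
rewrite !mxE; case: fintype.split => k; last exact: uw.
exact: ballxx.
Qed.

Lemma row_mx_differentiable (R : realType) m n (y : 'rV[R]_n) :
  differentiable (fun y => row_mx (0 : 'rV[R]_m) y) y.
Proof.
pose f (y : 'rV[R]_n) := row_mx (0 : 'rV[R]_m) y.
have flin : linear f.
  by move=> a u v; rewrite /f scale_row_mx add_row_mx scaler0 addr0.
pose fL : {linear 'rV[R]_n -> 'rV[R]_(m + n)} :=
  HB.pack f (GRing.isLinear.Build _ _ _ _ _ flin).
exact: (@linear_differentiable _ _ _ fL) (@row_mx_continuous _ _ _ _).
Qed.

Lemma dotC (R : realType) n (u v : 'rV[R]_n) : dot u v = dot v u.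
Proof. by apply: eq_bigr => a _; rewrite mulrC. Qed.

Lemma dotNr (R : realType) n (u v : 'rV[R]_n) : dot u (- v) = - dot u v.
Proof. by rewrite -sumrN; apply: eq_bigr => a _; rewrite mxE mulrN. Qed.

Lemma dot0l (R : realType) n (v : 'rV[R]_n) : dot 0 v = 0.
Proof. by apply: big1 => a _; rewrite mxE mul0r. Qed.

Lemma dot_delta (R : realType) n (u : 'rV[R]_n) a : dot (delta_mx 0 a) u = u 0 a.
Proof.
rewrite /dot (bigD1 a)//= mxE !eqxx mul1r big1 ?addr0// => b ba.
by rewrite mxE (negbTE ba) andbF mul0r.
Qed.

(** Adjointness of [B] and its transpose: this is what makes the contraction of a covector with a
    vector independent of the chart. *)
Lemma dot_mulmx_tr (R : realType) m n (u : 'rV[R]_m) (v : 'rV[R]_n)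
    (B : 'M[R]_(n, m)) : dot (u *m B^T) v = dot u (v *m B).
Proof.
have dotE k (x y : 'rV[R]_k) : dot x y = (x *m y^T) 0 0.
  by rewrite mxE; apply: eq_bigr => a _; rewrite mxE.
by rewrite !dotE trmx_mul mulmxA.
Qed.

Lemma differentiable_dot (R : realType) (V : normedModType R) n
    (f g : V -> 'rV[R]_n) (x : V) :
  differentiable f x -> differentiable g x ->
  differentiable (fun y => dot (f y) (g y) : R) x.
Proof.
move=> df dg.
have -> : (fun y => dot (f y) (g y) : R) =
    \sum_(a < n) (((fun M : 'rV[R]_n => M 0 a : R) \o f) *
                  ((fun M : 'rV[R]_n => M 0 a : R) \o g)).
  by apply/funext => y; rewrite fct_sumE.
apply: differentiable_sum => a; apply: differentiableM;
  by apply: differentiable_comp => //; exact: differentiable_coord.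
Qed.

Lemma row_mx_sum_delta (R : realType) m n (x : 'rV[R]_m) (y : 'rV[R]_n) :
  row_mx x y = \sum_a x 0 a *: row_mx (delta_mx 0 a) 0 +
               \sum_a y 0 a *: row_mx 0 (delta_mx 0 a).
Proof.
have -> : row_mx x y = row_mx x 0 + row_mx 0 y by rewrite add_row_mx addr0 add0r.
congr (_ + _).
  rewrite {1}(row_sum_delta x).
  rewrite (big_morph (fun u => row_mx u 0) (id1 := 0) (op1 := +%R)).
  - by apply: eq_bigr => a _; rewrite scale_row_mx scaler0.
  - by move=> u v; rewrite add_row_mx addr0.
  - exact: row_mx0.
rewrite {1}(row_sum_delta y) (big_morph (row_mx 0) (id1 := 0) (op1 := +%R)).
- by apply: eq_bigr => a _; rewrite scale_row_mx scaler0.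
- by move=> u v; rewrite add_row_mx addr0.
- exact: row_mx0.
Qed.

(** By differentiability ['D_u h y] is linear in [u], hence determined by its values in the
    coordinate directions. *)
Lemma derive_partial (R : realType) n (h : 'rV[R]_(n + n) -> R) y u :
  differentiable h y ->
  'D_u h y = dot (partial1 h y) (lsubmx u) + dot (partial2 h y) (rsubmx u).
Proof.
move=> dh; rewrite deriveE// -{1}(hsubmxK u) row_mx_sum_delta.
rewrite linearD !linear_sum; congr (_ + _); apply: eq_bigr => a _;
  by rewrite linearZ [in RHS]mxE deriveE// mulrC.
Qed.

(** * Charts of the natural atlases *)

(** Stated for a bare atlas, so that it applies to [TB A], [CB A] and products, which carry no
    manifold structure here. *)
Definition injective_charts (R : realType) (M : Type) n (A : atlas R M n) :=
  forall (i : chart_index A) m m',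
    dom i m -> dom i m' -> chart i m = chart i m' -> m = m'.

(** [transition i j] is meaningful only on the image of the chart [i]. The neighbourhood condition
    lets identities between transitions, valid on the overlap, pass to derivatives. *)
Definition differentiable_transitions (R : realType) (M : Type) n
    (A : atlas R M n) :=
  forall (i j : chart_index A) m, dom i m -> dom j m ->
    nbhs (chart i m) (chart i @` (dom i `&` dom j)) /\
    differentiable (transition i j) (chart i m).

(** [coord_rep] picks some preimage of [chart i m]; injectivity forces it to be [m]. *)
Lemma coord_repE (R : realType) (M : Type) n (A : atlas R M n)
    (W : normedModType R) (i : chart_index A) (f : M -> W) m :
  injective_charts A -> dom i m -> coord_rep i f (chart i m) = f m.
Proof.
move=> injA im; rewrite /coord_rep; case: pselect => [e|[]]; last by exists m.
by case: (cid e) => m' /= [im' /injA->].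
Qed.

Lemma tangent_eq (R : realType) (M : Type) n (A : atlas R M n) (x : M)
    (v w : tangent A x) : tcomp v = tcomp w -> v = w.
Proof.
case: v w => [v v1 v2] [w w1 w2] /= vw; case: _ / vw in w1 w2 *.
by rewrite (Prop_irrelevance v1 w1) (Prop_irrelevance v2 w2).
Qed.

Lemma cotangent_eq (R : realType) (M : Type) n (A : atlas R M n) (x : M)
    (v w : cotangent A x) : ccomp v = ccomp w -> v = w.
Proof.
case: v w => [v v1 v2] [w w1 w2] /= vw; case: _ / vw in w1 w2 *.
by rewrite (Prop_irrelevance v1 w1) (Prop_irrelevance v2 w2).
Qed.

(** The components in one chart determine those in every other chart around the base point, and the
    remaining ones are 0 by convention. *)
Lemma tangent_injective (R : realType) (M : Type) n (A : atlas R M n) :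
  injective_charts A -> injective_charts (tangent_atlas A).
Proof.
move=> injA i [x v] [x' v'] /= ix ix' /eq_row_mx[/(injA _ _ _ ix ix') xx'].
case: _ / xx' in v' ix' * => vv'; congr existT; apply: tangent_eq.
apply/funext => j; have [jx|jx] := pselect (dom j x); last by rewrite !tcomp_out.
by rewrite (tcomp_change v ix jx) (tcomp_change v' ix jx) vv'.
Qed.

Lemma cotangent_injective (R : realType) (M : Type) n (A : atlas R M n) :
  injective_charts A -> injective_charts (cotangent_atlas A).
Proof.
move=> injA i [x v] [x' v'] /= ix ix' /eq_row_mx[/(injA _ _ _ ix ix') xx'].
case: _ / xx' in v' ix' * => vv'; congr existT; apply: cotangent_eq.
apply/funext => j; have [jx|jx] := pselect (dom j x); last by rewrite !ccomp_out.
by rewrite (ccomp_change v jx ix) (ccomp_change v' jx ix) vv'.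
Qed.

Lemma real_injective (R : realType) : injective_charts (real_atlas R).
Proof. by move=> i s t _ _ /matrixP/(_ 0 0); rewrite !mxE. Qed.

Lemma prod_injective (R : realType) (M M' : Type) m n (A : atlas R M m)
    (B : atlas R M' n) :
  injective_charts A -> injective_charts B -> injective_charts (prod_atlas A B).
Proof.
move=> injA injB [i j] [x y] [x' y'] /= [ix jy] [ix' jy'] /eq_row_mx[].
by move=> /(injA _ _ _ ix ix')-> /(injB _ _ _ jy jy')->.
Qed.

(** * Smooth maps and transitions in charts *)

Lemma smooth_map_differentiable (R : realType) (M M' : Type) m n
    (A : atlas R M m) (B : atlas R M' n) (F : M -> M')
    (i : chart_index A) (j : chart_index B) x :
  smooth_map A B F -> dom i x -> dom j (F x) ->
  nbhs (chart i x) (chart i @` (dom i `&` F @^-1` dom j)) /\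
  differentiable (coord_rep i (chart j \o F)) (chart i x).
Proof.
move=> /(_ i j) /= []; rewrite setTI => oE sF ix jFx.
have Ex : (chart i @` (dom i `&` F @^-1` dom j)) (chart i x) by exists x.
split; first exact: open_nbhs_nbhs.
by have [+ _] := sF 1%N; apply.
Qed.

(** Differentiability is carried over from the maps: with a chart [k] around [G z], the transition
    from [i] to [j] is near [z] the representative of [G] from [i] to [k] followed by that of [F]
    from [k] to [j]. *)
Lemma diffeomorphism_transitions (R : realType) (M M' : Type) m n
    (A : atlas R M m) (B : atlas R M' n) (F : M -> M') :
  injective_charts A -> injective_charts B ->
  (forall x, exists i : chart_index A, dom i x) ->
  diffeomorphism A B F -> differentiable_transitions B.
Proof.
move=> injA injB covA [sF [G [FK GK sG]]] i j z iz jz.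
have [k kGz] := covA (G z).
have [nG dG] := smooth_map_differentiable sG iz kGz.
have jFGz : dom j (F (G z)) by rewrite GK.
have [nF dF] := smooth_map_differentiable sF kGz jFGz.
have GE z' : dom i z' -> coord_rep i (chart k \o G) (chart i z') = chart k (G z').
  by move=> iz'; rewrite coord_repE.
(* The overlap is a neighbourhood because the representative of [G] is continuous and pulls back the
   neighbourhood [nF] of [chart k (G z)]. *)
have nij : nbhs (chart i z)
    (chart i @` (dom i `&` dom j `&` G @^-1` dom k)).
  have cG : coord_rep i (chart k \o G) y @[y --> chart i z] --> chart k (G z).
    by rewrite -(GE z iz); exact: differentiable_continuous dG.
  apply: filterS2 nG (cG _ nF) => y [z' [iz' kGz'] <-] /=.
  rewrite GE// => -[x [kx jFx] /(injA _ _ _ kx kGz') xE].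
  by exists z' => //; split => //; split => //; rewrite -(GK z') -xE.
split.
  by apply: filterS nij => y [z' [[iz' jz'] _] <-]; exists z'.
apply: (@near_eq_differentiable _ _ _
  (coord_rep k (chart j \o F) \o coord_rep i (chart k \o G))).
  apply: filterS nij => y [z' [[iz' jz'] kGz'] <-] /=.
  by rewrite GE// /transition !coord_repE//= GK.
by apply: differentiable_comp => //; rewrite GE.
Qed.

(** * Jacobians of transitions and construction of tangent vectors *)

(** Chain rule; the factors appear in this order because Jacobians act on row vectors from the
    right. *)
Lemma jacobian_comp (R : realType) m n p (f : 'rV[R]_m -> 'rV[R]_n)
    (g : 'rV[R]_n -> 'rV[R]_p) x :
  differentiable f x -> differentiable g (f x) ->
  jacobian (g \o f) x = jacobian f x *m jacobian g (f x).
Proof.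
move=> df dg; apply/row_matrixP => a; rewrite !rowE mulmxA /jacobian.
by rewrite !mul_rV_lin1 diff_comp.
Qed.

Lemma row_jacobian (R : realType) m n (f : 'rV[R]_m -> 'rV[R]_n) x a :
  differentiable f x -> row a (jacobian f x) = 'D_(delta_mx 0 a) f x.
Proof. by move=> df; rewrite rowE deriveEjacobian. Qed.

Lemma near_eq_jacobian (R : realType) m n (f g : 'rV[R]_m -> 'rV[R]_n) x :
  {near x, f =1 g} -> differentiable f x -> jacobian f x = jacobian g x.
Proof.
move=> fg df; have dg := near_eq_differentiable fg df.
apply/row_matrixP => a.
apply: etrans (row_jacobian a df) (etrans _ (esym (row_jacobian a dg))).
exact: near_eq_derive.
Qed.

Lemma jacobian_transition_comp (R : realType) (M : Type) n (A : atlas R M n)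
    (i j k : chart_index A) x :
  injective_charts A -> differentiable_transitions A ->
  dom i x -> dom j x -> dom k x ->
  jacobian (transition i k) (chart i x) =
  jacobian (transition i j) (chart i x) *m jacobian (transition j k) (chart j x).
Proof.
move=> injA dA ix jx kx.
have [nij dij] := dA i j x ix jx; have [_ djk] := dA j k x jx kx.
have [_ dik] := dA i k x ix kx.
have ijE : transition i j (chart i x) = chart j x by exact: coord_repE.
move: djk; rewrite -ijE => djk.
apply: etrans (jacobian_comp dij djk); apply: near_eq_jacobian dik.
apply: filterS nij => y [x' [ix' jx'] <-] /=.
by rewrite /transition !coord_repE.
Qed.

Lemma jacobian_transition_id (R : realType) (M : Type) n (A : atlas R M n)
    (i : chart_index A) x :
  injective_charts A -> differentiable_transitions A -> dom i x ->
  jacobian (transition i i) (chart i x) = 1%:M.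
Proof.
move=> injA dA ix; have [ni di] := dA i i x ix ix.
have -> : jacobian (transition i i) (chart i x) = jacobian id (chart i x).
  apply: near_eq_jacobian di.
  by apply: filterS ni => y [x' [ix' _] <-]; exact: coord_repE.
apply/row_matrixP => a; rewrite row_jacobian// row1.
exact: derive_id.
Qed.

(** The row [u] is transported from chart [i] to every other chart by the Jacobian; the cocycle
    identity for Jacobians makes the resulting family compatible. *)
Lemma exists_tangent (R : realType) (M : Type) n (A : atlas R M n)
    (i : chart_index A) x (u : 'rV[R]_n) :
  injective_charts A -> differentiable_transitions A -> dom i x ->
  exists U : tangent A x, tcomp U i = u.
Proof.
move=> injA dA ix.
pose c j := if pselect (dom j x) then
  u *m jacobian (transition i j) (chart i x) else 0.
have cE j : dom j x -> c j = u *m jacobian (transition i j) (chart i x).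
  by rewrite /c; case: pselect.
have c1 j k : dom j x -> dom k x ->
    c k = c j *m jacobian (transition j k) (chart j x).
  move=> jx kx; rewrite (cE j jx) (cE k kx) -mulmxA; congr (_ *m _).
  exact: jacobian_transition_comp.
have c2 j : ~ dom j x -> c j = 0 by rewrite /c; case: pselect.
by exists (Tangent c1 c2); rewrite /= (cE i ix) jacobian_transition_id// mulmx1.
Qed.

(** [velocity] is a chosen value; a derivative in a chart being unique, any other velocity has the
    same components. *)
Lemma velocityE (R : realType) (M : Type) n (A : atlas R M n) (c : R -> M) t
    (v : tangent A (c t)) (i : chart_index A) :
  is_velocity v -> dom i (c t) -> tcomp (velocity A c t) i = tcomp v i.
Proof.
move=> cv it; have [_ ct] := cv i it.
have [|_ ct'] := (_ : is_velocity (velocity A c t)) i it.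
  by apply: xgetPex; exists v.
by rewrite -(@derive_val _ _ _ _ _ _ _ ct') (@derive_val _ _ _ _ _ _ _ ct).
Qed.

Lemma pairingE (R : realType) (M : Type) n (A : atlas R M n) (x : M)
    (p : cotangent A x) (v : tangent A x) (i : chart_index A) :
  dom i x -> pairing p v = dot (ccomp p i) (tcomp v i).
Proof.
move=> ix; rewrite /pairing; set S := [set s | _].
have : S (pairing p v); last exact.
apply: xgetPex; exists (dot (ccomp p i) (tcomp v i)) => j jx.
by rewrite (ccomp_change p ix jx) (tcomp_change v ix jx) dot_mulmx_tr.
Qed.

Lemma smooth_manifold_injective (R : realType) (M : topologicalType) n
    (A : atlas R M n) : smooth_manifold A -> injective_charts A.
Proof.
case=> _ _ dA _ _ i m m' im im'; have [_ injA] := dA i.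
by apply: injA; rewrite inE.
Qed.

(** * Consequences of the Legendre diffeomorphism *)

Lemma differentiable_hamiltonian (R : realType) (Q : Type) N (A : atlas R Q N)
    (L : TB A -> R) (H : CB A -> R) (i : chart_index A) (a : CB A) :
  injective_charts A ->
  smooth_map (tangent_atlas A) (real_atlas R) L ->
  nondegenerate_lagrangian L -> is_hamiltonian_of L H -> dom i (projT1 a) ->
  differentiable (coord_rep (A := cotangent_atlas A) i H)
                 (chart (a := cotangent_atlas A) i a).
Proof.
move=> injA sL [sF [G [FK GK sG]]] hH ia.
have injT := tangent_injective injA; have injC := cotangent_injective injA.
have injPL : injective_charts (PL_atlas A).
  by apply: prod_injective => //; exact: real_injective.
pose ch := chart (a := cotangent_atlas A) i.
(* [g] and [l] represent the inverse Legendre map and the Lagrangian in natural coordinates. *)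
pose g := coord_rep (A := PL_atlas A) (tt, i)
  (chart (a := jet_atlas A) (tt, i) \o G).
pose l := coord_rep (A := tangent_atlas A) i
  (chart (a := real_atlas R) tt \o L).
(* The Legendre map preserves base points, hence so does its inverse, and the same index [i] serves
   on both sides. *)
have projG z : projT1 (G z).2 = projT1 z.2 by rewrite -{2}(GK z).
(* [H] lives on the cotangent bundle alone, so [g] is only evaluated on the slice at time 0. *)
have gE b : dom i (projT1 b) ->
    g (row_mx 0 (ch b)) = chart (a := jet_atlas A) (tt, i) (G (0, b)).
  move=> ib; have -> : row_mx 0 (ch b) = chart (a := PL_atlas A) (tt, i) (0, b).
    by congr row_mx; apply/rowP => k; rewrite !mxE.
  by rewrite /g coord_repE.
(* [H = p.v - L] in coordinates: [p] is the second half of [ch b], and [v] the fibre part of the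
   inverse Legendre map at [(0, b)]. *)
have HE b : dom i (projT1 b) -> coord_rep (A := cotangent_atlas A) i H (ch b) =
    dot (rsubmx (ch b)) (rsubmx (rsubmx (g (row_mx 0 (ch b))))) -
    l (rsubmx (g (row_mx 0 (ch b)))) 0 0.
  move=> ib; rewrite gE// !row_mxKr coord_repE//.
  have iGb : dom i (projT1 (G (0, b)).2) by rewrite projG.
  rewrite /l coord_repE// /= mxE; set v := (G (0, b)).2.
  have bE : existT _ (projT1 v) (momentum L v) = b := congr1 snd (GK (0, b)).
  have -> : ccomp (projT2 b) i = ccomp (momentum L v) i by rewrite -bE.
  by have := hH v; rewrite bE (pairingE _ _ iGb).
have ia' : dom (a := PL_atlas A) (tt, i) (0, a) by [].
have iGa : dom (a := jet_atlas A) (tt, i) (G (0, a)) by split; rewrite //= projG.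
have [ng dg] := smooth_map_differentiable sG ia' iGa.
have [_ dl] := smooth_map_differentiable (j := tt : chart_index (real_atlas R)) sL iGa.2 I.
have zE : chart (a := PL_atlas A) (tt, i) (0, a) = row_mx 0 (ch a).
  by congr row_mx; apply/rowP => k; rewrite !mxE.
have drs m n (y : 'rV[R]_(m + n)) : differentiable (fun y => rsubmx y) y.
  exact: differentiable_rsubmx.
have dgr : differentiable (g \o row_mx 0) (ch a).
  apply: differentiable_comp; first exact: row_mx_differentiable.
  by rewrite -zE.
have drgr : differentiable ((fun y => rsubmx y) \o (g \o row_mx 0)) (ch a).
  exact: (differentiable_comp dgr (drs _ _ _)).
apply: (@near_eq_differentiable _ _ _ (fun y =>
    dot (rsubmx y) (rsubmx (rsubmx (g (row_mx 0 y)))) -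
    l (rsubmx (g (row_mx 0 y))) 0 0)).
  (* The formula holds only on the image of the chart. The slice map is continuous, so it pulls the
     neighbourhood given by [ng] back to one of [ch a]. *)
  have : nbhs (ch a) (row_mx (0 : 'rV_1) @^-1`
      (chart (a := PL_atlas A) (tt, i) @` dom (a := PL_atlas A) (tt, i))).
    apply: row_mx_continuous; rewrite -zE.
    by apply: filterS ng => y [z [iz _] <-]; exists z.
  apply: filterS => y [[t b] [_ ib]] /eq_row_mx[_ <-].
  by rewrite -/(ch b) -HE.
have rgE : rsubmx (g (row_mx 0 (ch a))) =
    chart (a := tangent_atlas A) i (G (0, a)).2 by rewrite gE// row_mxKr.
move: dl; rewrite -rgE => dl.
apply: differentiableB.
  exact: differentiable_dot (drs _ _ _) (differentiable_comp drgr (drs _ _ _)).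
exact: (differentiable_comp (differentiable_comp drgr dl)
  (differentiable_coord _ _ _)).
Qed.

Lemma legendre_transitions (R : realType) (Q : topologicalType) N
    (A : atlas R Q N) (L : TB A -> R) :
  smooth_manifold A -> nondegenerate_lagrangian L ->
  differentiable_transitions (PL_atlas A).
Proof.
move=> hA; have injA := smooth_manifold_injective hA.
apply: diffeomorphism_transitions.
- by apply: prod_injective; [exact: real_injective|exact: tangent_injective].
- by apply: prod_injective; [exact: real_injective|exact: cotangent_injective].
- case: hA => _ covA _ _ _ x; have [i ix] := covA (projT1 x.2).
  by exists (tt, i).
Qed.

(** * Hamilton's equations from the vanishing of the contracted form *)

(** The first coordinate of the curve in the chart is the identity function of time, whose
    derivative is 1. *)
Lemma velocity_time (R : realType) (M : Type) n (B : atlas R M n)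
    (c : R -> R * M) t (v : tangent (prod_atlas (real_atlas R) B) (c t))
    (i : chart_index B) :
  (forall s, (c s).1 = s) -> is_velocity v -> dom i (c t).2 ->
  lsubmx (tcomp v (tt, i) : 'rV_(1 + n)) 0 0 = 1.
Proof.
move=> c1 cv it; have [//|_ [dc <-]] := cv (tt, i) _.
rewrite derive_mx// !mxE.
have tE : (fun s => (chart (a := prod_atlas (real_atlas R) B) (tt, i) (c s)) 0
    (lshift n 0)) = id by apply/funext => s; rewrite /= row_mxEl mxE c1.
by apply: etrans (congr1 (fun f : R -> R => 'D_1 f t) tE) _; exact: derive_id.
Qed.

Lemma interior_OmegaH_eq0 (R : realType) (Q : Type) N (A : atlas R Q N)
    (H : CB A -> R) (i : chart_index A) (z : R * CB A)
    (W : tangent (PL_atlas A) z) :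
  let h := coord_rep (A := cotangent_atlas A) i H in
  let y := chart (a := cotangent_atlas A) i z.2 in
  injective_charts A -> differentiable_transitions (PL_atlas A) ->
  differentiable h y -> dom i (projT1 z.2) ->
  lsubmx (tcomp W (tt, i) : 'rV_(1 + (N + N))) 0 0 = 1 ->
  (forall U, OmegaH H i U W = 0) <->
  tcomp W (tt, i)
    = row_mx (const_mx 1) (row_mx (partial2 h y) (- partial1 h y)).
Proof.
move=> h y injA dPL dh iz.
rewrite /OmegaH -/h -/y.
set w : 'rV_(1 + (N + N)) := tcomp W (tt, i) => w1; split => [OW|wE U].
  have injPL : injective_charts (PL_atlas A).
    apply: prod_injective; first exact: real_injective.
    exact: cotangent_injective.
  (* A test vector without time component removes the term [dH(W) dt(U)]. Such a vector exists with
     arbitrary remaining components [u]. *)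
  have OWu u : dot (lsubmx u) (rsubmx (rsubmx w)) -
      dot (lsubmx (rsubmx w)) (rsubmx u) + 'D_u h y = 0.
    have [U UE] : exists U : tangent (PL_atlas A) z,
        tcomp U (tt, i) = row_mx (0 : 'rV_1) u by exact: exists_tangent.
    have := OW U; rewrite UE row_mxKl row_mxKr w1 mulr1.
    have -> : (0 : 'rV[R]_1) 0 0 = 0 by rewrite mxE.
    by rewrite mulr0 subr0.
  rewrite -(hsubmxK w) -(hsubmxK (rsubmx w)); congr row_mx.
    by apply/rowP => k; rewrite ord1 w1 mxE.
  congr row_mx; apply/rowP => a.
    (* The direction of [p_a] isolates the [q]-component of [W]. *)
    have := OWu (row_mx 0 (delta_mx 0 a)).
    rewrite row_mxKl row_mxKr dot0l (dotC _ (delta_mx _ _)) dot_delta sub0r.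
    by move=> /eqP; rewrite addrC subr_eq0 => /eqP <-; rewrite mxE.
  (* The direction of [q^a] isolates the [p]-component, with the opposite sign. *)
  have := OWu (row_mx (delta_mx 0 a) 0).
  rewrite row_mxKl row_mxKr dot_delta (dotC _ 0) dot0l subr0 => /eqP.
  by rewrite addr_eq0 => /eqP ->; rewrite 2!mxE.
(* Conversely, [dH(W) = p1.p2 - p2.p1 = 0] (conservation of energy), so the time component of [U]
   drops out; the other terms cancel against [dH(U)]. *)
move: wE; rewrite w1 mulr1 2!(derive_partial _ dh).
move: (partial1 h y) (partial2 h y) => p1 p2 wE.
have -> : rsubmx w = row_mx p2 (- p1) by rewrite wE row_mxKr.
rewrite row_mxKl row_mxKr !dotNr (dotC p1 p2) subrr mul0r subr0.
by rewrite (dotC _ p1) (dotC p2) -opprD addNr.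
Qed.

Theorem proposition4p1 (R : realType) (N : nat) (Q : topologicalType)
  (A : atlas R Q N) (hQ : smooth_manifold A)
  (L : TB A -> R) (hL : smooth_map (tangent_atlas A) (real_atlas R) L)
  (hFL : nondegenerate_lagrangian L)
  (H : CB A -> R) (hH : is_hamiltonian_of L H)
  (V : vector_field (PL_atlas A)) (hV : smooth_vector_field V) :
  (forall (J : set R) (q : R -> Q),
      local_section A J q -> integral_curve V J (jtilde L q) ->
      (hamiltonian_along H V (jtilde L q @` J)
       <-> hamiltonian_section L H J q))
  /\
  ((forall z : R * CB A, exists (J : set R) (q : R -> Q),
      [/\ local_section A J q, integral_curve V J (jtilde L q)
        & (jtilde L q @` J) z]) ->
   (hamiltonian_vector_field H V
    <-> forall (J : set R) (q : R -> Q),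
          local_section A J q -> integral_curve V J (jtilde L q) ->
          hamiltonian_section L H J q)).
Proof.
have injA := smooth_manifold_injective hQ.
(* The equivalence holds point by point and chart by chart along one integral curve; both claims of
   the theorem follow from it. *)
have along J q : integral_curve V J (jtilde L q) ->
    (hamiltonian_along H V (jtilde L q @` J) <-> hamiltonian_section L H J q).
  move=> qV.
  have OmegaHP t i : J t -> dom i (q t) ->
      (forall U, OmegaH H i U (velocity (PL_atlas A) (jtilde L q) t) = 0) <->
      tcomp (V (jtilde L q t)) (tt, i) = row_mx (const_mx 1)
        (row_mx (partial2 (coord_rep (A := cotangent_atlas A) i H)
                   (chart (a := cotangent_atlas A) i (jtilde L q t).2))
                (- partial1 (coord_rep (A := cotangent_atlas A) i H)
                   (chart (a := cotangent_atlas A) i (jtilde L q t).2))).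
    move=> Jt it; have vt := qV t Jt.
    have it' : dom (a := PL_atlas A) (tt, i) (jtilde L q t) by [].
    (* On an integral curve the components of [V] are those of the velocity, which is the vector
       entering [hamiltonian_section]. *)
    have vE := velocityE vt it'; rewrite -vE.
    apply: interior_OmegaH_eq0 => //.
    - exact: legendre_transitions hQ hFL.
    - exact: differentiable_hamiltonian hFL hH _.
    - rewrite vE; exact: (velocity_time _ vt).
  split=> [HV t Jt U i it|HS _ [t Jt <-] i it].
    by apply: (OmegaHP t i Jt it).2; apply: HV => //; exists t.
  by apply/(OmegaHP t i Jt it) => U; exact: HS.
split=> [J q _|curves]; first exact: along.
split=> [HV J q _ qV|HS z _].
  by apply/(along J q qV) => z _; exact: HV.
(* An integral curve of the required form passes through [z], so the statement along curves gives
   Hamilton's equations at every point. *)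
have [J [q [qJ qV Jz]]] := curves z.
exact: (along J q qV).2 (HS J q qJ qV) z Jz.
Qed.
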